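(* Let $(D,\tau,d,\Delta)$ be an instance of TMO in which $t$ is reachable from $s$. Then there exists a convoy routing $(\boldsymbol{P},\boldsymbol{\sigma})$ whose induced train routing is an optimal feasible train routing, i.e. its makespan $\max_{i\in[k]}\{\tau(P_i)+(\sigma_i-1)\Delta\}$ equals the minimum makespan over all feasible train routings.
   Context: An instance of Train Makespan Optimization (TMO) is $(D,\tau,d,\Delta)$ where $D=(V,A)$ is a directed graph (parallel arcs allowed) with a source $s$ and sink $t$, $\tau:A\to\mathbb{Z}_{\ge0}$ are travel times, $d\in\mathbb{Z}_{\ge1}$ is the number of identical trains and $\Delta\in\mathbb{Z}_{\ge1}$ is the headway. A train routing $(\boldsymbol{P},\boldsymbol{\lambda})$ consists, for each train $i\in[d]$, of an $s$-$t$-path $P_i$ in $D$ and an entry function $\lambda_i:P_i\to\mathbb{Z}_{\ge0}$ ($\lambda_i(a)$ is the time train $i$ enters arc $a$). It is feasible if (i) $\lambda_i(a)+\tau_a\le\lambda_i(a')$ for every $i$ and every pair of consecutive arcs $a,a'$ on $P_i$ (waiting at nodes is allowed), and (ii) $|\lambda_i(a)-\lambda_{i'}(a)|\ge\Delta$ for all $i\neq i'$ and all $a\in P_i\cap P_{i'}$. Its makespan is $\max_{i\in[d]}\max_{a\in P_i}(\lambda_i(a)+\tau_a)$. A convoy routing $(\boldsymbol{P},\boldsymbol{\sigma})$ consists of $k\le d$ pairwise arc-disjoint $s$-$t$-paths $P_1,\dots,P_k$ and $\boldsymbol{\sigma}\in\mathbb{Z}_{\ge1}^k$ with $\sum_i\sigma_i=d$;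 it induces the feasible train routing in which $\sigma_i$ trains traverse $P_i$ without waiting, the $j$-th of them ($j=1,\dots,\sigma_i$) entering the first arc of $P_i$ at time $(j-1)\Delta$. Its makespan is $\max_{i\in[k]}\{\tau(P_i)+(\sigma_i-1)\Delta\}$, where $\tau(P)=\sum_{a\in P}\tau_a$. *)

(* Defs.v *)
From mathcomp Require Import all_boot all_order.
Set Implicit Arguments. Unset Strict Implicit. Unset Printing Implicit Defensive.

(* A directed multigraph: vertices V, arcs A (parallel arcs allowed), each arc
   a has tail (tl a) and head (hd a).  Times are non-negative integers (nat). *)
Section TMO.
Variables (V A : finType) (tl hd : A -> V) (s t : V) (tau : A -> nat).

Fixpoint walk_to (v : V) (p : seq A) : bool :=
  match p with
  | [::] => v == t
  | a :: p' => (tl a == v) && walk_to (hd a) p'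
  end.

Definition st_path (p : seq A) : bool :=
  walk_to s p && uniq (s :: map hd p).

Definition tau_sum (p : seq A) : nat := \sum_(a <- p) tau a.

Variables (d Delta : nat).

(* Train routing: P i is the path of train i, lam i a the time train i enters arc a
   (only the values on arcs of P i are relevant). *)
Definition feasible (P : 'I_d -> seq A) (lam : 'I_d -> A -> nat) : Prop :=
  (forall i, st_path (P i)) /\
  (forall i, sorted (fun a a' => lam i a + tau a <= lam i a') (P i)) /\
  (forall i i', i != i' -> forall a, a \in P i -> a \in P i' ->
      (Delta + lam i' a <= lam i a) \/ (Delta + lam i a <= lam i' a)).

Definition makespan (P : 'I_d -> seq A) (lam : 'I_d -> A -> nat) : nat :=
  \max_(i < d) \max_(a <- P i) (lam i a + tau a).

Definition convoy_routing (k : nat) (Q : 'I_k -> seq A) (sigma : 'I_k -> nat) : Prop :=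
  (forall i, st_path (Q i)) /\
  (forall i j, i != j -> forall a, a \in Q i -> a \notin Q j) /\
  (forall i, 0 < sigma i) /\
  \sum_(i < k) sigma i = d.

Definition convoy_makespan (k : nat) (Q : 'I_k -> seq A) (sigma : 'I_k -> nat) : nat :=
  \max_(i < k) (tau_sum (Q i) + (sigma i - 1) * Delta).

(* (P, lam) is the train routing induced by the convoy routing (Q, sigma):
   train x is assigned to path f x; the trains on path Q i are exactly sigma i
   many, ranked r x = 0, ..., sigma i - 1 (bijectively), and the train of rank r
   enters the first arc at time r*Delta and traverses Q i without waiting. *)
Definition induced (k : nat) (Q : 'I_k -> seq A) (sigma : 'I_k -> nat)
    (P : 'I_d -> seq A) (lam : 'I_d -> A -> nat) : Prop :=
  exists (f : 'I_d -> 'I_k) (r : 'I_d -> nat),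
    (forall x, P x = Q (f x)) /\
    (forall i, #|[set x | f x == i]| = sigma i) /\
    (forall x, r x < sigma (f x)) /\
    (forall x y, f x = f y -> r x = r y -> x = y) /\
    (forall x a, a \in P x ->
        lam x a = r x * Delta + tau_sum (take (index a (P x)) (P x))).

End TMO.

(* Main.v *)
Require Import Defs.
From mathcomp Require Import all_boot all_order.
From mathcomp Require Import zify.
From Stdlib Require Import Classical.
Set Implicit Arguments. Unset Strict Implicit. Unset Printing Implicit Defensive.

(** Given any feasible routing of makespan [T], each arc is regarded as an
intermediary of a supply chain: it buys at most one train from a preceding arc,
preferring early entry times, and sells at most one train to a following arc,
preferring late ones, provided that the train bought does not enter after the
train sold.  A stable outcome exists as a least fixpoint.  It consists of
arc-disjoint chains from [s] to [t], and by stability each train [i] uses an arc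
of some chain at a time between those of the train bought and the train sold.
If [n] trains enter an arc between the bought and the sold one (inclusive), a
chain switching there from the former to the latter skips [(n - 1) * Delta] units
of time; consecutive arcs share the train traded, so a chain met by [n] trains
has length at most [T - (n - 1) * Delta] and can serve as the path of a convoy of
[n] trains.  If [s = t], all paths are empty and [d] convoys of size
one are used. *)

(** * Consecutive arcs on a path *)

Definition follows (A : eqType) (p : seq A) (a b : A) : bool :=
  (b \in p) && (index b p == (index a p).+1).

Section Follows.
Variables (A : eqType) (p : seq A).

Lemma follows_meml (a b : A) : follows p a b -> a \in p.
Proof.
by case/andP; rewrite -!index_mem => lb /eqP e; apply: ltn_trans lb; rewrite e.
Qed.

Lemma follows_memr (a b : A) : follows p a b -> b \in p.
Proof. by case/andP. Qed.

Lemma follows_index (a b : A) : follows p a b -> index b p = (index a p).+1.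
Proof. by case/andP=> _ /eqP. Qed.

Lemma follows_funr (a b c : A) : follows p a b -> follows p a c -> b = c.
Proof.
by move=> /andP[pb /eqP eb] /andP[pc /eqP ec]; apply: (index_inj a pb pc); rewrite eb ec.
Qed.

Lemma follows_funl (a b c : A) : follows p a c -> follows p b c -> a = b.
Proof.
move=> fa fb; apply: (index_inj a (follows_meml fa) (follows_meml fb)).
by apply: succn_inj; rewrite -(follows_index fa) (follows_index fb).
Qed.

Lemma follows_nth (a : A) n :
  uniq p -> n.+1 < size p -> follows p (nth a p n) (nth a p n.+1).
Proof.
by move=> up ln; rewrite /follows mem_nth ?index_uniq ?(ltnW ln) ?eqxx.
Qed.

Lemma follows_prev (a : A) :
  uniq p -> a \in p -> index a p != 0 -> exists b, follows p b a.
Proof.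
move=> up pa; case e: (index a p) => [//|n] _; exists (nth a p n).
by have := @follows_nth a n up; rewrite -e nth_index // index_mem; apply.
Qed.

Lemma follows_next (a : A) :
  uniq p -> (index a p).+1 < size p -> exists b, follows p a b.
Proof.
move=> up i1; exists (nth a p (index a p).+1).
by have := follows_nth a up i1; rewrite nth_index // -index_mem ltnW.
Qed.

Lemma sorted_follows (e : rel A) (a b : A) : sorted e p -> follows p a b -> e a b.
Proof.
move=> /(sortedP a) se f.
rewrite -(nth_index a (follows_meml f)) -(nth_index a (follows_memr f)).
rewrite (follows_index f); apply: se.
by rewrite -(follows_index f) index_mem (follows_memr f).
Qed.

End Follows.

(** * Walks to the sink and removal of their cycles *)

Section Walks.
Variables (V A : finType) (tl hd : A -> V) (t : V).

Lemma walk_to_sorted (v : V) (p : seq A) :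
  walk_to tl hd t v p -> sorted (fun a b => hd a == tl b) p.
Proof.
elim: p v => //= a p IH v /andP[_ w]; have := IH _ w.
by case: p w {IH} => //= b p /andP[/eqP-> _] ->; rewrite eqxx.
Qed.

Lemma walk_to_first (v : V) (p : seq A) (a : A) :
  walk_to tl hd t v p -> a \in p -> index a p = 0 -> tl a = v.
Proof. by case: p => //= b p /andP[/eqP<- _] _; case: eqP => // ->. Qed.

Lemma walk_to_last (v : V) (p : seq A) (a : A) :
  walk_to tl hd t v p -> a \in p -> (index a p).+1 = size p -> hd a = t.
Proof.
elim: p v => //= b p IH v /andP[_ w]; rewrite inE eq_sym.
case: eqP => [<- _ [/esym/size0nil p0]|_ /= pa [/(IH _ w pa)]//].
by move: w; rewrite p0 => /eqP.
Qed.

Lemma path_walk_to (a : A) (p : seq A) :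
  path (fun a b => hd a == tl b) a p -> hd (last a p) = t ->
  walk_to tl hd t (tl a) (a :: p).
Proof.
elim: p a => [|b p IH] a /=; first by rewrite eqxx => _ ->; rewrite eqxx.
by case/andP=> /eqP e pb /(IH _ pb) /=; rewrite e !eqxx.
Qed.

Lemma walk_to_suffix (v u : V) (p : seq A) :
  walk_to tl hd t v p -> uniq (v :: map hd p) -> u \in v :: map hd p ->
  exists q, [/\ walk_to tl hd t u q, uniq (u :: map hd q) & subseq q p].
Proof.
elim: p v => [|a p IH] v w un; rewrite in_cons => /orP[/eqP->|//].
- by exists [::].
- by exists (a :: p).
move=> up; case/andP: w => _ w.
have [|q [wq uq sq]] := IH _ w _ up; first by case/andP: un.
by exists q; split=> //; apply: subseq_trans sq (subseq_cons _ _).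
Qed.

(** If [v] recurs on the cycle-free rest [q], the part of [q] from [v] on replaces the whole walk.
    Passing to a subsequence keeps arc-disjointness and, as times are non-negative, does not
    increase the travel time. *)
Lemma walk_to_shortcut (v : V) (p : seq A) :
  walk_to tl hd t v p ->
  exists q, [/\ walk_to tl hd t v q, uniq (v :: map hd q) & subseq q p].
Proof.
elim: p v => [|a p IH] v; first by exists [::].
case/andP=> ta /IH[q [wq uq sq]].
have [vq|vq] := boolP (v \in hd a :: map hd q).
  have [r [wr ur sr]] := walk_to_suffix wq uq vq.
  exists r; split=> //; apply: subseq_trans sr _.
  by apply: subseq_trans sq (subseq_cons _ _).
by exists (a :: q); split; rewrite /= ?ta ?eqxx // vq.
Qed.

Lemma tau_sum_cons (tau : A -> nat) (a : A) (p : seq A) :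
  tau_sum tau (a :: p) = tau a + tau_sum tau p.
Proof. exact: big_cons. Qed.

Lemma tau_sum_subseq (tau : A -> nat) (p q : seq A) :
  subseq p q -> tau_sum tau p <= tau_sum tau q.
Proof.
rewrite /tau_sum; elim: q p => [|b q IH] [|a p] //=; first by rewrite big_nil.
case: eqP => [<- s|_ s]; first by rewrite !big_cons leq_add2l IH.
by rewrite [leqRHS]big_cons; apply: leq_trans (leq_addl _ _); apply: IH.
Qed.

End Walks.

(** Pigeonhole: cut time from [lo] on into windows of length [Delta]. Separated times lie in
    distinct windows, and [(hi - lo) %/ Delta + 1] windows reach up to [hi]. *)
Lemma card_separated (I : finType) (Z : {set I}) (x : I -> nat) (Delta lo hi : nat) :
  0 < Delta -> 0 < #|Z| ->
  {in Z &, forall i j, i != j -> Delta + x j <= x i \/ Delta + x i <= x j} ->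
  {in Z, forall i, lo <= x i <= hi} ->
  lo + (#|Z| - 1) * Delta <= hi.
Proof.
move=> D0 Z0 sep bnd.
have [k Zk] := card_gt0P Z0; have lohi : lo <= hi by have := bnd k Zk; lia.
pose g i : 'I_((hi - lo) %/ Delta).+1 := inord ((x i - lo) %/ Delta).
have gE i : i \in Z -> g i = (x i - lo) %/ Delta :> nat.
  by move=> /bnd b; rewrite inordK // ltnS leq_div2r //; lia.
have : #|Z| <= #|'I_((hi - lo) %/ Delta).+1|.
  apply: (@leq_card_in _ _ g) => i j Zi Zj /(congr1 val) /=; rewrite !gE // => e.
  apply/eqP/negPn/negP => /(sep _ _ Zi Zj).
  have := bnd _ Zi; have := bnd _ Zj.
  have := divn_eq (x i - lo) Delta; have := divn_eq (x j - lo) Delta.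
  have := ltn_pmod (x i - lo) D0; have := ltn_pmod (x j - lo) D0.
  rewrite e; lia.
rewrite card_ord; set m := _ %/ _ => le.
have : (#|Z| - 1) * Delta <= m * Delta by rewrite leq_mul2r; lia.
have := leq_divM (hi - lo) Delta; rewrite -/m; lia.
Qed.

(** * Existence of a stable outcome *)

Section Stable.
Variables (I A : finType) (P : I -> seq A) (lam : I -> A -> nat).
Implicit Types B S : I -> A -> bool.

(* Let [p] be the earliest time at [a] of the trains in [B] (offered to [a]) and
   [q] the latest time of those in [S] (that [a] can resell), with [p] infinite
   and [q] minus infinity if there are none. Then [beyond] says that
   [lam i a >= max p q], and [before] that [lam i a <= min p q]. *)
Definition beyond B S (i : I) (a : A) : bool :=
  [exists j, B j a && (lam j a <= lam i a)] &&
  [forall j, S j a ==> (lam j a <= lam i a)].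

Definition before B S (i : I) (a : A) : bool :=
  [forall j, B j a ==> (lam i a <= lam j a)] &&
  [exists j, S j a && (lam i a <= lam j a)].

Lemma beyond_mono B B' S S' i a :
  (forall j b, B' j b -> B j b) -> (forall j b, S j b -> S' j b) ->
  beyond B' S' i a -> beyond B S i a.
Proof.
move=> sB sS /andP[/existsP[j /andP[Bj l]] /forallP h]; apply/andP; split.
  by apply/existsP; exists j; rewrite sB.
by apply/forallP=> k; apply/implyP=> /sS; apply/implyP.
Qed.

Lemma before_mono B B' S S' i a :
  (forall j b, B' j b -> B j b) -> (forall j b, S j b -> S' j b) ->
  before B S i a -> before B' S' i a.
Proof.
move=> sB sS /andP[/forallP h /existsP[j /andP[Sj l]]]; apply/andP; split.
  by apply/forallP=> k; apply/implyP=> /sB; apply/implyP.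
by apply/existsP; exists j; rewrite sS.
Qed.

(** [beyond] grows with [B] and shrinks with [S], and [before] does the opposite, so the two
    conditions form one monotone system in the complement of [B] and [S]. The inner quantifiers are
    vacuous at the ends of [P i]: the source offers every train, and the sink accepts every
    train. *)
Lemma stable_offers : exists B S,
  (forall i a, B i a =
     (a \in P i) && [forall b, follows (P i) b a ==> beyond B S i b]) /\
  (forall i a, S i a =
     (a \in P i) && [forall b, follows (P i) a b ==> before B S i b]).
Proof.
(* The flag [false] records offers withdrawn from [B], the flag [true] offers present in [S]:
   enlarging [X] shrinks [Bx X] and enlarges [Sx X]. *)
pose Bx (X : {set bool * (I * A)}) i a := (a \in P i) && ((false, (i, a)) \notin X).
pose Sx (X : {set bool * (I * A)}) i a := (a \in P i) && ((true, (i, a)) \in X).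
pose F X := [set u : bool * (I * A) | let: (c, (i, a)) := u in
  if c then [forall b, follows (P i) a b ==> before (Bx X) (Sx X) i b]
  else ~~ [forall b, follows (P i) b a ==> beyond (Bx X) (Sx X) i b]].
have monoF : {homo F : X Y / X \subset Y}.
  move=> X Y /subsetP sXY.
  have sB j b : Bx Y j b -> Bx X j b.
    by rewrite /Bx => /andP[-> /=]; apply: contra => /sXY.
  have sS j b : Sx X j b -> Sx Y j b by rewrite /Sx => /andP[-> /=]; apply: sXY.
  apply/subsetP=> -[[] [i a]]; rewrite !inE.
    move=> /forallP h; apply/forallP=> b; apply/implyP=> f.
    by apply: (before_mono sB sS); apply: (implyP (h b)).
  apply: contra => /forallP h; apply/forallP=> b; apply/implyP=> f.
  by apply: (beyond_mono sB sS); apply: (implyP (h b)).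
have fixF := fixsetK monoF; set X := fixset F in fixF.
exists (Bx X), (Sx X); split=> i a; rewrite {1}/Bx {1}/Sx -{1}fixF inE //.
by rewrite negbK.
Qed.

End Stable.

(** * Trades in the stable outcome *)

Section Chains.
Variables (V A I : finType) (tl hd : A -> V) (s t : V) (tau : A -> nat).
Variables (Delta T : nat) (P : I -> seq A) (lam : I -> A -> nat) (B S : I -> A -> bool).
Hypothesis Delta_gt0 : 0 < Delta.
Hypothesis st_neq : s != t.
Hypothesis P_path : forall i, st_path tl hd s t (P i).
Hypothesis P_sorted :
  forall i, sorted (fun a a' => lam i a + tau a <= lam i a') (P i).
Hypothesis P_sep : forall i i', i != i' -> forall a, a \in P i -> a \in P i' ->
  (Delta + lam i' a <= lam i a) \/ (Delta + lam i a <= lam i' a).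
Hypothesis P_le : forall i a, a \in P i -> lam i a + tau a <= T.
Hypothesis B_def : forall i a, B i a =
  (a \in P i) && [forall b, follows (P i) b a ==> beyond lam B S i b].
Hypothesis S_def : forall i a, S i a =
  (a \in P i) && [forall b, follows (P i) a b ==> before lam B S i b].

Let P_walk i : walk_to tl hd t s (P i).
Proof. by case/andP: (P_path i). Qed.

Let P_uniq i : uniq (P i).
Proof. by case/andP: (P_path i) => _ /= /andP[_ /map_uniq]. Qed.

Let B_mem i a : B i a -> a \in P i.
Proof. by rewrite B_def => /andP[]. Qed.

Let S_mem i a : S i a -> a \in P i.
Proof. by rewrite S_def => /andP[]. Qed.

Let same_time i j a : a \in P i -> a \in P j -> lam i a = lam j a -> i = j.
Proof.
move=> Pi Pj e; apply/eqP/negPn/negP => /P_sep /(_ a Pi Pj); lia.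
Qed.

(* [inn x a] and [out y a]: arc [a] buys train [x], respectively sells train [y],
   in the stable outcome. *)
Definition inn x a := B x a && before lam B S x a.
Definition out y a := S y a && beyond lam B S y a.
(** Phrased by offers rather than by the trains traded, since it yields the existence of both a
    bought and a sold train, with [i] entering between them. *)
Definition touch i a := [&& a \in P i,
  [exists j, B j a && (lam j a <= lam i a)] &
  [exists k, S k a && (lam i a <= lam k a)]].
Definition link a b := [exists y, out y a && follows (P y) a b].

(** Being offered to [b] unfolds to [beyond] at the preceding arc [a]; being wanted by [b] makes [x]
    resalable at [a], as only [b] follows [a] on the path. *)
Lemma inn_pred x a b : inn x b -> follows (P x) a b -> out x a.
Proof.
case/andP=> Bx bx f; apply/andP; split.
  rewrite S_def (follows_meml f); apply/forallP=> c; apply/implyP=> fc.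
  by rewrite -(follows_funr f fc).
by move: Bx; rewrite B_def => /andP[_ /forallP/(_ a)]; rewrite f.
Qed.

Lemma out_next y a b : out y a -> follows (P y) a b -> inn y b.
Proof.
case/andP=> Sy ey f; apply/andP; split.
  rewrite B_def (follows_memr f); apply/forallP=> c; apply/implyP=> fc.
  by rewrite -(follows_funl f fc).
by move: Sy; rewrite S_def => /andP[_ /forallP/(_ b)]; rewrite f.
Qed.

Lemma inn_min x a j : inn x a -> B j a -> lam x a <= lam j a.
Proof. by case/andP=> _ /andP[/forallP/(_ j)/implyP]. Qed.

Lemma out_max y a j : out y a -> S j a -> lam j a <= lam y a.
Proof. by case/andP=> _ /andP[_ /forallP/(_ j)/implyP]. Qed.

Lemma inn_uniq x y a : inn x a -> inn y a -> x = y.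
Proof.
move=> hx hy; have [[Bx _] [By _]] := (andP hx, andP hy).
by apply: (@same_time x y a); rewrite ?B_mem //; apply/eqP;
   rewrite eqn_leq !inn_min.
Qed.

Lemma out_uniq x y a : out x a -> out y a -> x = y.
Proof.
move=> hx hy; have [[Sx _] [Sy _]] := (andP hx, andP hy).
by apply: (@same_time x y a); rewrite ?S_mem //; apply/eqP;
   rewrite eqn_leq !out_max.
Qed.

Lemma touch_inn i a : touch i a -> exists2 x, inn x a & lam x a <= lam i a.
Proof.
case/and3P=> _ /existsP[j /andP[Bj lj]] /existsP[k /andP[Sk lk]].
case: (@arg_minnP _ j (B^~ a) (lam^~ a) Bj) => x Bx minx.
have lx := minx _ Bj; exists x; last by lia.
apply/and3P; split=> //.
  by apply/forallP=> z; apply/implyP; apply: minx.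
by apply/existsP; exists k; rewrite Sk; lia.
Qed.

Lemma touch_out i a : touch i a -> exists2 y, out y a & lam i a <= lam y a.
Proof.
case/and3P=> _ /existsP[j /andP[Bj lj]] /existsP[k /andP[Sk lk]].
case: (@arg_maxnP _ k (S^~ a) (lam^~ a) Sk) => y Sy maxy.
have ly := maxy _ Sk; exists y; last by lia.
apply/and3P; split=> //.
  by apply/existsP; exists j; rewrite Bj; lia.
by apply/forallP=> z; apply/implyP; apply: maxy.
Qed.

Lemma inn_touch x a : inn x a -> touch x a.
Proof.
case/and3P=> Bx _ ex; apply/and3P; split=> //; first exact: B_mem.
by apply/existsP; exists x; rewrite Bx leqnn.
Qed.

Lemma out_touch y a : out y a -> touch y a.
Proof.
case/and3P=> Sy ey _; apply/and3P; split=> //; first exact: S_mem.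
by apply/existsP; exists y; rewrite Sy leqnn.
Qed.

(* A train met by no chain would be accepted arc after arc, hence into the sink. *)
Lemma touch_exists i : exists a, touch i a.
Proof.
apply/existsP; apply: contraT => /existsPn nt.
have BB a : a \in P i -> B i a.
  have [n] := ubnP (index a (P i)); elim: n a => // n IH a lt Pa.
  rewrite B_def Pa; apply/forallP=> b; apply/implyP=> f.
  have Bb : B i b.
    by apply: IH (follows_meml f); rewrite -ltnS -(follows_index f).
  apply/andP; split; first by apply/existsP; exists i; rewrite Bb leqnn.
  (* As [i] is offered to [b], a resalable train entering [b] later than [i] would make [i] touch
     [b]. *)
  apply/forallP=> k; apply/implyP=> Sk; rewrite leqNgt; apply/negP=> lt'.
  case/negP: (nt b); apply/and3P; split; first exact: follows_meml f.
    by apply/existsP; exists i; rewrite Bb leqnn.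
  by apply/existsP; exists k; rewrite Sk ltnW.
case e: (P i) (P_walk i) => [|a0 p] w; first by have := st_neq; rewrite (w : s == t).
pose a := last a0 p.
have Pa : a \in P i by rewrite e mem_last.
have ia : (index a (P i)).+1 = size (P i).
  by rewrite e /a (last_nth a0) index_uniq // -e.
case/negP: (nt a); apply/and3P; split=> //.
  by apply/existsP; exists i; rewrite BB ?leqnn.
(* No arc follows the last one, so [i] is resalable there and touches it. *)
apply/existsP; exists i; rewrite leqnn andbT S_def Pa.
apply/forallP=> b; apply/implyP=> f.
by have := follows_memr f; rewrite -index_mem (follows_index f) ia ltnn.
Qed.

(** * Links between arcs and progress along them *)

Lemma link_funr a b c : link a b -> link a c -> b = c.
Proof.
case/existsP=> x /andP[ox fx] /existsP[y /andP[oy fy]].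
by move: fx; rewrite (out_uniq ox oy) => /follows_funr; apply.
Qed.

Lemma link_funl a b c : link a c -> link b c -> a = b.
Proof.
case/existsP=> x /andP[ox fx] /existsP[y /andP[oy fy]].
have e := inn_uniq (out_next ox fx) (out_next oy fy); rewrite e in fx.
exact: follows_funl fx fy.
Qed.

Lemma link_walk a b : link a b -> hd a == tl b.
Proof.
case/existsP=> y /andP[_]; apply: (@sorted_follows _ _ (fun a b => hd a == tl b)).
exact: walk_to_sorted (P_walk y).
Qed.

Lemma follows_time i a b : follows (P i) a b -> lam i a + tau a <= lam i b.
Proof. exact: (@sorted_follows _ _ (fun a b => lam i a + tau a <= lam i b)). Qed.

(* The second component breaks the ties caused by arcs of travel time 0. *)
Definition progress x a := lam x a * #|A|.+1 + index a (P x).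

(** If [x] enters [a] before [y], the gain in time outweighs any loss of index, which is at most
    [#|A|]. Otherwise they enter simultaneously, so [x = y] by the headway, and the index grows. *)
Lemma progress_lt x y a b : inn x a -> out y a -> follows (P y) a b ->
  progress x a < progress y b.
Proof.
move=> ix oy f; have [x' ix' lx] := touch_inn (out_touch oy).
rewrite -(inn_uniq ix ix') in lx; have ly := follows_time f.
have Px := B_mem (proj1 (andP ix)); have Py := S_mem (proj1 (andP oy)).
rewrite /progress; have [e|ne] := eqVneq (lam x a) (lam y a).
  by rewrite (same_time Px Py e) (follows_index f); nia.
have : index a (P x) < #|A|.+1.
  rewrite ltnS; apply: leq_trans (index_size _ _) _.
  by rewrite -(card_uniqP (P_uniq x)) max_card.
nia.
Qed.

Lemma progress_bound x a : inn x a -> progress x a < T.+1 * #|A|.+1.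
Proof.
move=> ix; have Px := B_mem (proj1 (andP ix)); have := P_le Px.
have : index a (P x) < #|A|.+1.
  rewrite ltnS; apply: leq_trans (index_size _ _) _.
  by rewrite -(card_uniqP (P_uniq x)) max_card.
rewrite /progress; nia.
Qed.

(** * Trains met by a chain and a bound on its length *)

Definition touched (p : seq A) := [set i | has (touch i) p].

Lemma touched_at x y a : inn x a -> out y a ->
  lam x a + (#|[set i | touch i a]| - 1) * Delta <= lam y a.
Proof.
move=> ix oy; apply: card_separated => //.
- by apply/card_gt0P; exists x; rewrite inE inn_touch.
- move=> i j; rewrite !inE => /and3P[Pi _ _] /and3P[Pj _ _] ne.
  exact: (P_sep ne Pi Pj).
- move=> i; rewrite inE => ti.
  have [x' ix' lx] := touch_inn ti; have [y' oy' ly] := touch_out ti.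
  by rewrite (inn_uniq ix ix') (out_uniq oy oy') lx.
Qed.

(** The time from the entry of [x] into [a] to [T] is spent on the gap between [x] and the sold
    train [y], the travel of [y] along [a], and the rest of the chain, which starts with [y] bought
    at the next arc. *)
Lemma chain_to_end x a : inn x a -> exists p,
  [/\ path link a p, hd (last a p) = t, forall b, ~~ link (last a p) b &
      lam x a + tau_sum tau (a :: p) + (#|touched (a :: p)| - 1) * Delta <= T].
Proof.
have [n] := ubnP (T.+1 * #|A|.+1 - progress x a).
elim: n x a => // n IH x a le ix.
have [y oy lxy] := touch_out (inn_touch ix).
have Py := S_mem (proj1 (andP oy)).
have := touched_at ix oy; set Z := [set i | _] => cZ.
have [last_a|nlast] := leqP (size (P y)) (index a (P y)).+1.
  exists [::]; split=> //=.
  - apply: (walk_to_last (P_walk y) Py).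
    by apply/eqP; rewrite eqn_leq last_a andbT index_mem.
  - move=> b; apply/negP=> /existsP[z /andP[/(out_uniq oy)<- f]].
    by have := follows_memr f; rewrite -index_mem (follows_index f) ltnNge last_a.
  - have -> : touched [:: a] = Z.
      by apply/setP=> i; rewrite !inE /= orbF.
    have := P_le Py; rewrite /tau_sum big_seq1; lia.
have [b f] : exists b : A, follows (P y) a b by apply: follows_next.
have iy := out_next oy f; have lt := progress_lt ix oy f.
have [|p [pp lp np bp]] := IH y b _ iy.
  have := progress_bound iy; lia.
exists (b :: p); split=> //=.
  by rewrite pp andbT; apply/existsP; exists y; rewrite oy.
have tE : touched [:: a, b & p] = Z :|: touched (b :: p).
  by apply/setP=> i; rewrite !inE.
have yI : 0 < #|Z :&: touched (b :: p)|.
  apply/card_gt0P; exists y; rewrite !inE /= (out_touch oy).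
  by rewrite (inn_touch iy).
(* The train [y] touches both [a] and [b]; counting it once makes the two terms lowered by one add
   up. *)
have cU := cardsUI Z (touched (b :: p)); rewrite -tE in cU.
have y0 : 0 < #|touched (b :: p)|.
  by apply: leq_trans yI (subset_leq_card (subsetIr _ _)).
have z0 : 0 < #|Z| by apply: leq_trans yI (subset_leq_card (subsetIl _ _)).
have cD : (#|touched [:: a, b & p]| - 1) * Delta <=
    (#|Z| - 1) * Delta + (#|touched (b :: p)| - 1) * Delta.
  by rewrite -mulnDl leq_mul2r; lia.
have ft := follows_time f; rewrite tau_sum_cons; lia.
Qed.

(** * Disjoint chains from source to sink *)

Definition start r := [exists x, inn x r && (index r (P x) == 0)].

Lemma start_nolink r a : start r -> ~~ link a r.
Proof.
case/existsP=> x /andP[ix /eqP e]; apply/negP=> /existsP[y /andP[oy f]].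
by have := follows_index f; rewrite -(inn_uniq ix (out_next oy f)) e.
Qed.

Lemma start_tail r : start r -> tl r = s.
Proof.
case/existsP=> x /andP[/andP[/B_mem Px _] /eqP].
exact: walk_to_first (P_walk x) Px.
Qed.

(** Going back along the path of the bought train lowers [progress], so this stops, necessarily at
    an arc that buys directly from the source. *)
Lemma chain_from_start x a : inn x a -> exists r p,
  [/\ start r, path link r p & last r p = a].
Proof.
have [n] := ubnP (progress x a); elim: n x a => // n IH x a le ix.
have Px := B_mem (proj1 (andP ix)).
have [i0|i0] := eqVneq (index a (P x)) 0.
  by exists a, [::]; split=> //; apply/existsP; exists x; rewrite ix i0.
have [b f] := follows_prev (P_uniq x) Px i0.
have ob := inn_pred ix f; have [z iz _] := touch_inn (out_touch ob).
have lt := progress_lt iz ob f.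
have [|r [p [sr pp lp]]] := IH z b _ iz; first by lia.
exists r, (rcons p a); split; rewrite ?last_rcons // rcons_path pp lp /=.
by apply/existsP; exists x; rewrite ob.
Qed.

Lemma path_prefix r p a : a \in r :: p -> path link r p ->
  exists2 p1, path link r p1 & last r p1 = a.
Proof.
by case/splitPl=> p1 p2 e; rewrite cat_path => /andP[pp _]; exists p1.
Qed.

(** Links are injective, so both paths can be shortened from their common end in step. They run out
    together, as no link enters a start. *)
Lemma start_inj r r' p p' : start r -> start r' ->
  path link r p -> path link r' p' -> last r p = last r' p' -> r = r'.
Proof.
move=> sr sr'; elim/last_ind: p p' => [|p a IH] p'.
  case/lastP: p' => //= p' a _; rewrite rcons_path last_rcons => /andP[_ l] e.
  by move: l; rewrite -e => l; case/negP: (start_nolink (last r' p') sr).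
rewrite rcons_path last_rcons => /andP[pp l].
case/lastP: p' => [_ /= e|p' b].
  by move: l; rewrite e => l; case/negP: (start_nolink (last r p) sr').
rewrite rcons_path last_rcons => /andP[pp' l'] e; apply: (IH p') => //.
by apply: link_funl l _; rewrite e.
Qed.

Lemma start_disjoint r r' p p' a : start r -> start r' ->
  path link r p -> path link r' p' -> a \in r :: p -> a \in r' :: p' -> r = r'.
Proof.
move=> sr sr' pp pp' /path_prefix/(_ pp)[p1 pp1 e1] /path_prefix/(_ pp')[p2 pp2 e2].
by apply: (start_inj sr sr' pp1 pp2); rewrite e1 e2.
Qed.

Lemma path_maximal r p q : path link r p -> path link r q ->
  (forall b, ~~ link (last r q) b) -> last r p \in r :: q.
Proof.
elim: p r q => [|b p IH] r q /=; first by rewrite mem_head.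
case/andP=> l pp; case: q => [_ /(_ b)|c q] /=; first by rewrite l.
case/andP=> /(link_funr l)<- pq h; rewrite inE; apply/orP; right.
exact: IH.
Qed.

(** Chains are indexed by their starts, and [root i] starts a chain touching [i]. The trains sharing
    a root all touch its chain, so the bound on the chain covers their convoy. *)
Lemma disjoint_chains : exists (root : I -> A) (Q : A -> seq A),
  [/\ forall i, walk_to tl hd t s (Q (root i)),
      forall i j, root i != root j ->
        forall a, a \in Q (root i) -> a \notin Q (root j) &
      forall i, tau_sum tau (Q (root i)) +
        (#|[set j | root j == root i]| - 1) * Delta <= T].
Proof.
have [Q hQ] : exists Q : A -> seq A, forall r, start r ->
    [/\ path link r (Q r), hd (last r (Q r)) = t, forall b, ~~ link (last r (Q r)) b &
      tau_sum tau (r :: Q r) + (#|touched (r :: Q r)| - 1) * Delta <= T].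
  apply: (@fin_all_exists _ (fun=> seq A) (fun r q => start r ->
    [/\ path link r q, hd (last r q) = t, forall b, ~~ link (last r q) b &
      tau_sum tau (r :: q) + (#|touched (r :: q)| - 1) * Delta <= T])) => r.
  (* Away from starts the chosen value is arbitrary. *)
  have [/existsP[x /andP[ix _]]|ns] := boolP (start r); last by exists [::].
  have [q [pq lq nq bq]] := chain_to_end ix; exists q => _; split=> //.
  by apply: leq_trans bq; rewrite -addnA leq_addl.
have [root hroot] : exists root : I -> A, forall i,
    start (root i) /\ i \in touched (root i :: Q (root i)).
  apply: (@fin_all_exists _ (fun=> A) (fun i r =>
    start r /\ i \in touched (r :: Q r))) => i.
  have [a ta] := touch_exists i; have [x ix _] := touch_inn ta.
  have [r [p [sr pp lp]]] := chain_from_start ix.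
  have [pq _ nq _] := hQ r sr; exists r; split=> //; rewrite inE.
  by apply/hasP; exists a => //; rewrite -lp path_maximal.
exists root, (fun r => r :: Q r); split=> [i|i j ne a Qi|i].
- have [sr _] := hroot i; have [pq lq _ _] := hQ _ sr.
  by rewrite -(start_tail sr); apply: path_walk_to lq; apply: sub_path pq; apply: link_walk.
- have [[si _] [sj _]] := (hroot i, hroot j); apply: contra ne => Qj.
  have [[pi _ _ _] [pj _ _ _]] := (hQ _ si, hQ _ sj).
  by apply/eqP; apply: start_disjoint si sj pi pj Qi Qj.
have [sr _] := hroot i; have [_ _ _] := hQ _ sr; apply: leq_trans.
rewrite leq_add2l leq_mul2r leq_sub2r ?orbT //; apply: subset_leq_card.
by apply/subsetP=> j; rewrite inE => /eqP<-; case: (hroot j).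
Qed.

End Chains.

(** * Convoy routings and the train routings they induce *)

Section Convoys.
Variables (V A : finType) (tl hd : A -> V) (s t : V) (tau : A -> nat).
Variables (d Delta : nat).

Definition load (k : nat) (f : 'I_d -> 'I_k) (i : 'I_k) : nat := #|[set x | f x == i]|.

Definition rank (k : nat) (f : 'I_d -> 'I_k) (x : 'I_d) : nat :=
  #|[set y | (f y == f x) && (y < x)]|.

Lemma rank_lt_load k (f : 'I_d -> 'I_k) x : rank f x < load f (f x).
Proof.
apply: proper_card; apply/properP; split.
  by apply/subsetP=> y; rewrite !inE => /andP[].
by exists x; rewrite !inE ?eqxx ?ltnn.
Qed.

Lemma rank_mono k (f : 'I_d -> 'I_k) x y : f x = f y -> x < y -> rank f x < rank f y.
Proof.
move=> e lt; apply: proper_card; apply/properP; split.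
  by apply/subsetP=> z; rewrite !inE e => /andP[-> /ltn_trans->].
by exists x; rewrite !inE e ?eqxx ?ltnn.
Qed.

Lemma rank_inj k (f : 'I_d -> 'I_k) x y : f x = f y -> rank f x = rank f y -> x = y.
Proof.
move=> e er; apply: val_inj; case: (ltngtP x y) => // lt.
  by have := rank_mono e lt; rewrite er ltnn.
by have := rank_mono (esym e) lt; rewrite er ltnn.
Qed.

(** Take the train of largest index on the path. It attains the makespan of its convoy. *)
Lemma rank_last k (f : 'I_d -> 'I_k) i :
  0 < load f i -> exists2 x, f x = i & rank f x = load f i - 1.
Proof.
case/card_gt0P=> z; rewrite inE => fz.
case: (@arg_maxnP _ z (fun x => f x == i) (@nat_of_ord d) fz) => x /eqP fx maxx.
exists x => //; rewrite /load (cardsD1 x) inE fx eqxx add1n subn1 /=.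
apply: eq_card => y; rewrite !inE fx; have [fy|_] := eqVneq (f y) i; last first.
  by rewrite andbF.
have le : y <= x by apply: maxx; rewrite fy.
by rewrite andbT /= ltn_neqAle le andbT.
Qed.

Lemma sum_load k (f : 'I_d -> 'I_k) : \sum_(i < k) load f i = d.
Proof.
rewrite -[RHS]card_ord -sum1_card (partition_big f xpredT) //=.
by apply: eq_bigr => i _; rewrite sum1_card /load cardsE.
Qed.

Lemma tau_sum_take_index (p : seq A) (a : A) : a \in p ->
  tau_sum tau (take (index a p) p) + tau a = tau_sum tau (take (index a p).+1 p).
Proof.
move=> pa; rewrite (take_nth a) ?index_mem // nth_index //.
by rewrite /tau_sum -cats1 big_cat big_seq1.
Qed.

Lemma tau_sum_take_le (p : seq A) n : tau_sum tau (take n p) <= tau_sum tau p.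
Proof. exact/tau_sum_subseq/take_subseq. Qed.

(** [makespan] sees a train only through its arcs, so an empty path contributes 0 to it; the convoy
    formula agrees there exactly when a single train is assigned. This explains the second premise
    of the equality. *)
Lemma convoy_feasible k (Q : 'I_k -> seq A) (f : 'I_d -> 'I_k) :
  (forall i, st_path tl hd s t (Q i)) ->
  (forall i j, i != j -> forall a, a \in Q i -> a \notin Q j) ->
  exists (P : 'I_d -> seq A) (lam : 'I_d -> A -> nat),
    [/\ induced tau Delta Q (load f) P lam, feasible tl hd s t tau Delta P lam &
        (forall i, 0 < load f i) -> (forall i, Q i = [::] -> load f i = 1) ->
        makespan tau P lam = convoy_makespan tau Delta Q (load f)].
Proof.
move=> pQ dQ; exists (fun x => Q (f x)).
exists (fun x a => rank f x * Delta + tau_sum tau (take (index a (Q (f x))) (Q (f x)))).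
split.
- exists f, (rank f); do !split=> //; [exact: rank_lt_load | exact: rank_inj].
- split=> //; split=> [x|x y xy a Qx Qy].
    have uQ : uniq (Q (f x)) by case/andP: (pQ (f x)) => _ /= /andP[_ /map_uniq].
    case e : (Q (f x)) => [//|a0 p]; rewrite -e; apply/(sortedP a0) => n lt.
    rewrite !index_uniq // ?(ltnW lt) // -addnA leq_add2l.
    have := tau_sum_take_index (mem_nth a0 (ltnW lt)).
    by rewrite index_uniq ?(ltnW lt) // => ->.
  have [e|ne] := eqVneq (f x) (f y); last by case/negP: (dQ _ _ ne _ Qx).
  have ner : rank f x != rank f y by apply: contra xy => /eqP/(rank_inj e)->.
  (* On a common path the travel time up to [a] cancels, leaving distinct multiples of [Delta]. *)
  rewrite e !addnA !leq_add2r -!mulSn !leq_mul2r.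
  have /orP[lt|lt] : (rank f x < rank f y) || (rank f y < rank f x) by lia.
    by right; rewrite lt orbT.
  by left; rewrite lt orbT.
move=> l0 l1; apply/eqP; rewrite eqn_leq; apply/andP; split.
  apply/bigmax_leqP=> x _; apply/bigmax_leqP_seq=> a Qa _.
  rewrite -addnA tau_sum_take_index // addnC.
  apply: leq_trans (leq_bigmax (f x)); apply: leq_add (tau_sum_take_le _ _) _.
  by rewrite leq_mul2r; have := rank_lt_load f x; lia.
apply/bigmax_leqP=> i _; have [x fx rx] := rank_last (l0 i).
case e : (Q i) => [|a0 p]; first by rewrite l1 // /tau_sum big_nil.
have Qa : last a0 p \in Q i by rewrite e mem_last.
apply: leq_trans (leq_bigmax x); rewrite fx.
apply: leq_trans (leq_bigmax_seq (last a0 p) Qa isT).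
rewrite -addnA tau_sum_take_index // rx addnC leq_add2l -e.
rewrite take_oversize // {2}e (last_nth a0) -[_ :: _]e index_uniq //; first by rewrite e.
  by rewrite e.
by case/andP: (pQ i) => _ /= /andP[_ /map_uniq].
Qed.

Lemma convoy_below (P : 'I_d -> seq A) (lam : 'I_d -> A -> nat) :
  0 < d -> 0 < Delta -> feasible tl hd s t tau Delta P lam ->
  exists k (Q : 'I_k -> seq A) (f : 'I_d -> 'I_k),
    [/\ forall i, st_path tl hd s t (Q i),
        forall i j, i != j -> forall a, a \in Q i -> a \notin Q j,
        forall i, 0 < load f i,
        forall i, Q i = [::] -> load f i = 1 &
        convoy_makespan tau Delta Q (load f) <= makespan tau P lam].
Proof.
move=> d0 D0 [pP [sP sepP]].
have [st|st] := eqVneq s t.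
  have l1 i : load (@id 'I_d) i = 1.
    by rewrite /load -[RHS](cards1 i); apply: eq_card => x; rewrite !inE.
  exists d, (fun=> [::]), id; split=> // [i|i|].
  - by rewrite /st_path /= st eqxx.
  - by rewrite l1.
  - by apply/bigmax_leqP=> i _; rewrite l1 /tau_sum big_nil.
have leT i a : a \in P i -> lam i a + tau a <= makespan tau P lam.
  move=> Pa; apply: leq_trans (leq_bigmax i).
  exact: (@leq_bigmax_seq _ _ _ (fun a => lam i a + tau a) a Pa).
have [B [S [defB defS]]] := stable_offers P lam.
have [root [Q0 [wQ dQ bQ]]] := disjoint_chains D0 st pP sP sepP leT defB defS.
have [Q hQ] : exists Q : A -> seq A, forall r, walk_to tl hd t s (Q0 r) ->
    [/\ walk_to tl hd t s (Q r), uniq (s :: map hd (Q r)) & subseq (Q r) (Q0 r)].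
  apply: (@fin_all_exists _ (fun=> seq A) (fun r q => walk_to tl hd t s (Q0 r) ->
    [/\ walk_to tl hd t s q, uniq (s :: map hd q) & subseq q (Q0 r)])) => r.
  have [/walk_to_shortcut[q hq]|nw] := boolP (walk_to tl hd t s (Q0 r)).
    by exists q.
  by exists [::].
(* Only roots in use index convoys, so that every convoy has a train. *)
pose R := [set root i | i in 'I_d].
have Rr x : root x \in R by apply: imset_f.
pose x0 := Ordinal d0.
pose f x : 'I_#|R| := enum_rank_in (Rr x0) (root x).
have fE x : enum_val (f x) = root x by apply: enum_rankK_in.
have valR (i : 'I_#|R|) : exists x, f x = i.
  have /imsetP[x _ e] := enum_valP i.
  by exists x; apply: enum_val_inj; rewrite fE.
have loadE x : load f (f x) = #|[set j | root j == root x]|.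
  by apply: eq_card => y; rewrite !inE -(inj_eq enum_val_inj) !fE.
exists #|R|, (fun i => Q (enum_val i)), f; split=> [i|i j ne a|i|i|].
- by have [x <-] := valR i; rewrite fE; have [w u _] := hQ _ (wQ x); apply/andP.
- have [[x ex] [y ey]] := (valR i, valR j); rewrite -ex -ey !fE.
  have [_ _ sx] := hQ _ (wQ x); have [_ _ sy] := hQ _ (wQ y).
  move=> /(mem_subseq sx) Qa; apply/negP=> /(mem_subseq sy); apply/negP.
  by apply: dQ Qa; apply: contra ne => /eqP e; rewrite -ex -ey /f e.
- by have [x <-] := valR i; apply: leq_ltn_trans (rank_lt_load f x).
- have [x <-] := valR i; rewrite fE; have [w _ _] := hQ _ (wQ x) => e.
  by move: w st; rewrite e /= => ->.
apply/bigmax_leqP=> i _; have [x <-] := valR i; rewrite fE loadE.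
have [_ _ sx] := hQ _ (wQ x); apply: leq_trans (bQ x).
by rewrite leq_add2r tau_sum_subseq.
Qed.

End Convoys.

(** * Existence of an optimum and conclusion *)

Lemma exists_minimum (p : nat -> Prop) :
  (exists n, p n) -> exists2 n, p n & forall m, p m -> n <= m.
Proof.
case=> n; elim/ltn_ind: n => n IH pn.
(* Excluded middle replaces a decision procedure: the predicate applied later quantifies over all
   routings. *)
have [[m lt pm]|h] := classic (exists2 m, m < n & p m); first exact: IH pm.
by exists n => // m pm; rewrite leqNgt; apply/negP => lt; apply: h; exists m.
Qed.

Theorem theorem2 (V A : finType) (tl hd : A -> V) (s t : V) (tau : A -> nat)
    (d Delta : nat) (d_pos : 0 < d) (Delta_pos : 0 < Delta)
    (reach : exists p, st_path tl hd s t p) :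
  exists (k : nat) (Q : 'I_k -> seq A) (sigma : 'I_k -> nat),
    convoy_routing tl hd s t d Q sigma /\
    exists (P : 'I_d -> seq A) (lam : 'I_d -> A -> nat),
      induced tau Delta Q sigma P lam /\
      feasible tl hd s t tau Delta P lam /\
      makespan tau P lam = convoy_makespan tau Delta Q sigma /\
      (forall (P' : 'I_d -> seq A) (lam' : 'I_d -> A -> nat),
          feasible tl hd s t tau Delta P' lam' ->
          makespan tau P lam <= makespan tau P' lam').
Proof.
have [|T [P0 [lam0 [feas0 <-]]] minT] := @exists_minimum (fun T => exists P lam,
    feasible (d := d) tl hd s t tau Delta P lam /\ makespan tau P lam = T).
  have [p pp] := reach.
  (* A single convoy of all trains on the given path witnesses feasibility. *)
  have [|i j|P [lam [_ feas _]]] := @convoy_feasible _ _ tl hd s t tau d Delta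
      1 (fun=> p) (fun=> ord0) => //.
    by rewrite !ord1.
  by exists (makespan tau P lam), P, lam.
have [k [Q [f [pQ dQ l0 l1 le]]]] := convoy_below d_pos Delta_pos feas0.
have [P [lam [ind feas mk]]] := convoy_feasible tau Delta f pQ dQ.
exists k, Q, (load f); split; first by do !split=> //; apply: sum_load.
exists P, lam; do !split=> //; first exact: mk.
move=> P' lam' feas'; rewrite mk //; apply: leq_trans le _.
by apply: minT; exists P', lam'.
Qed.
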